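(* Let $n\mid(q+1)$, let $\delta\ge3$ be odd, and let $b,s,m$ be positive integers with $\gcd(b,n)=1$. Let $t\in\{0,\dots,n-1\}$ and let $i_1<\dots<i_s$ be integers with $m-1+\delta\le i_1$, $i_s\le n-\delta$ and $i_{\ell+1}-i_\ell\ge\delta$ for $\ell=1,\dots,s-1$. Put $$A=\{\alpha^{t},\alpha^{t+b},\dots,\alpha^{t+(m-1)b},\alpha^{t+i_1b},\dots,\alpha^{t+i_sb}\},\qquad B=\{\alpha^{jb}: -\tfrac{\delta-3}{2}\le j\le\tfrac{\delta-1}{2}\}.$$ Suppose $\{j:\alpha^j\in AB\}$ is a union of $q$-cyclotomic cosets modulo $n$. Let $d_A^{\perp}$ be the minimum distance of the dual of the cyclic code of length $n$ over $\mathbb{F}_{q^2}$ with complete defining set $A$. Then $C_{AB}$ is a cyclic $(d_A^{\perp}-\delta+1,\delta)$-LRC of length $n$ over $\mathbb{F}_q$ with dimension $k=n-m+1-(s+1)(\delta-1)$. Moreover, if $\lceil k/r\rceil=s+1$ where $r=d_A^{\perp}-\delta+1$, then $C_{AB}$ is an optimal $(r,\delta)$-LRC with minimum distance $m+\delta-1$.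
   Context: Let $q$ be a prime power and $n\mid(q+1)$, so the set $R_n$ of all $n$-th roots of unity lies in $\mathbb{F}_{q^2}$; let $\alpha\in\mathbb{F}_{q^2}$ be a primitive $n$-th root of unity. For $A,B\subseteq R_n$, $AB=\{\beta\gamma:\beta\in A,\gamma\in B\}$. For $Z\subseteq R_n$, the cyclic code of length $n$ over $\mathbb{F}_{q^2}$ with complete defining set $Z$ is the ideal generated by $\prod_{\beta\in Z}(x-\beta)$ in $\mathbb{F}_{q^2}[x]/(x^n-1)$; if $\{j:\alpha^j\in Z\}$ is a union of $q$-cyclotomic cosets modulo $n$ (equivalently here, closed under $j\mapsto -j \bmod n$), this polynomial lies in $\mathbb{F}_q[x]$ and $C_Z$ denotes the cyclic code of length $n$ over $\mathbb{F}_q$ it generates (dimension $n-|Z|$). Locality: for a linear code $C\subseteq\mathbb{F}_q^n$ and integers $r\ge1$, $\delta\ge2$, the $i$-th coordinate has $(r,\delta)$-locality if there is $S_i\subseteq\{1,\dots,n\}$ with $i\in S_i$, $|S_i|\le r+\delta-1$ such that the punctured code $C|_{S_i}$ has minimum distance at least $\delta$; $C$ is an $(r,\delta)$-LRC if every coordinate has $(r,\delta)$-locality. An $[n,k,d]$ $(r,\delta)$-LRC is optimal if $d=n-k-(\lceil k/r\rceil-1)(\delta-1)+1$ (always an upper bound on $d$). *)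

(* Defs.v *)
From HB Require Import structures.
From mathcomp Require Import all_boot all_order all_algebra all_field.
Set Implicit Arguments. Unset Strict Implicit. Unset Printing Implicit Defensive.
Import Order.TTheory GRing.Theory Num.Theory.
Local Open Scope ring_scope.

Section Codes.
Variable R : finFieldType.
Variable n : nat.

Definition wt (c : 'rV[R]_n) : nat := #|[set i | c ord0 i != 0%R]|.

Definition is_min_dist (C : {set 'rV[R]_n}) (d : nat) : Prop :=
  (exists2 c, c \in C & (c != 0) /\ wt c = d) /\
  (forall c, c \in C -> c != 0 -> (d <= wt c)%N).

Definition dual_code (C : {set 'rV[R]_n}) : {set 'rV[R]_n} :=
  [set x : 'rV[R]_n | [forall c in C, \sum_(i < n) x ord0 i * c ord0 i == 0]].

Definition code_dim (C : {set 'rV[R]_n}) : nat := \dim <<enum C>>%VS.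

(* cyclic: invariant under the cyclic shift, i.e. multiplication by X mod X^n-1 *)
Definition is_cyclic (C : {set 'rV[R]_n}) : Prop :=
  forall c, c \in C -> poly_rV (('X * rVpoly c) %% ('X^n - 1)) \in C.

(* coordinate i has (r,delta)-locality: some S containing i, |S| <= r+delta-1,
   such that the punctured code C|_S has minimum distance >= delta, i.e. every
   codeword whose restriction to S is nonzero has at least delta nonzero
   coordinates in S. *)
Definition has_locality (r delta : nat) (C : {set 'rV[R]_n}) (i : 'I_n) : Prop :=
  exists S : {set 'I_n},
    [/\ i \in S, (#|S| <= r + delta - 1)%N &
      forall c, c \in C -> [exists j in S, c ord0 j != 0%R] ->
        (delta <= #|[set j in S | c ord0 j != 0%R]|)%N].

Definition is_LRC (r delta : nat) (C : {set 'rV[R]_n}) : Prop :=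
  [/\ (1 <= r)%N, (2 <= delta)%N & forall i : 'I_n, has_locality r delta C i].

Definition ceil_div (k r : nat) : nat := ((k + r - 1) %/ r)%N.

(* optimal (r,delta)-LRC: attains the Singleton-like bound *)
Definition is_optimal_LRC (r delta : nat) (C : {set 'rV[R]_n}) : Prop :=
  is_LRC r delta C /\
  exists d, is_min_dist C d /\
    (d%:Z = n%:Z - (code_dim C)%:Z
             - ((ceil_div (code_dim C) r)%:Z - 1) * (delta%:Z - 1) + 1)%R.

End Codes.

Definition gen_poly (K : finFieldType) (Z : {set K}) : {poly K} :=
  \prod_(beta in Z) ('X - beta%:P).

(* cyclic code of length n over K with complete defining set Z: the ideal
   generated by gen_poly Z in K[x]/(x^n-1); residues are represented by
   polynomials of degree < n, i.e. by rVpoly of a row vector. *)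
Definition cyc_code (K : finFieldType) (n : nat) (Z : {set K}) : {set 'rV[K]_n} :=
  [set c : 'rV[K]_n | [exists f : 'rV[K]_n,
     rVpoly c == (rVpoly f * gen_poly Z) %% ('X^n - 1)]].

(* The code C_Z over F (embedded in K via iota): the ideal of F[x]/(x^n-1)
   generated by gen_poly Z (which lies in F[x] when the exponent set of Z is a
   union of q-cyclotomic cosets). *)
Definition cyc_code_sub (F K : finFieldType) (iota : {rmorphism F -> K}) (n : nat)
    (Z : {set K}) : {set 'rV[F]_n} :=
  [set c : 'rV[F]_n | [exists f : 'rV[F]_n,
     map_poly iota (rVpoly c) ==
       (map_poly iota (rVpoly f) * gen_poly Z) %% ('X^n - 1)]].

(* Main.v *)
Require Import Defs.
From HB Require Import structures.
From mathcomp Require Import all_boot all_order all_algebra all_field.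
From mathcomp Require Import zify.
Import Order.TTheory GRing.Theory Num.Theory.
Local Open Scope ring_scope.

(* Let x be a dual word of the code with defining set A and c a codeword of
   C_AB. For every y in B the word (c_j y^j)_j has all of A among its zeros, so
   the coordinatewise product of x and c has the delta - 1 consecutive zeros B
   and, by the BCH bound, is zero or has weight at least delta: the cyclic shifts
   of the support of x are recovery sets. The BCH bound also gives d_A^perp >=
   delta, from the gap between the exponents m - 1 and i_1 of A, and
   d >= m + delta - 1, from the first run of consecutive exponents of AB. The
   reverse inequality is the Singleton-like bound for LRCs. *)

(** * Vanishing power sums and weight *)

Lemma row_neq0_coord (R : nmodType) (n : nat) (v : 'rV[R]_n) :
  v != 0 -> exists j, v ord0 j != 0.
Proof.
move=> v0; apply/existsP; apply: contraNT v0; rewrite negb_exists => /forallP v0.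
by apply/eqP/rowP => j; rewrite mxE; apply/eqP; rewrite -[_ == _]negbK.
Qed.

(** Lagrange interpolation in place of a Vandermonde determinant: if the support had at most [w]
    points, the polynomial vanishing at the [x j] for all support points except [j0] would have
    degree below [w]. The power sums then annihilate a sum whose only nonzero term is the one at
    [j0]. *)
Lemma power_sums_weight (K : fieldType) (I : finType) (v x : I -> K) (w : nat) :
    injective x ->
    (forall l, (l < w)%N -> \sum_j v j * x j ^+ l = 0) ->
  forall j0, v j0 != 0 -> (w < #|[set j | v j != 0%R]|)%N.
Proof.
move=> x_inj v0 j0 vj0; set S := [set j | v j != 0].
have j0S : j0 \in S by rewrite inE.
rewrite ltnNge; apply/negP => leSw.
pose P := \prod_(y <- [seq x j | j <- enum (S :\ j0)]) ('X - y%:P).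
have sP : (size P <= w)%N.
  by rewrite size_prod_XsubC size_map -cardE (leq_trans _ leSw) // (cardsD1 j0 S) j0S.
have: \sum_j v j * P.[x j] = 0.
  under eq_bigr do rewrite (horner_coef_wide _ sP) mulr_sumr.
  rewrite exchange_big big1 //= => l _.
  under eq_bigr do rewrite mulrCA.
  by rewrite -mulr_sumr v0 ?mulr0.
rewrite (bigD1 j0) //= big1 => [/eqP|j jj0].
  rewrite addr0 mulf_eq0 (negPf vj0) /= -rootE root_prod_XsubC => /mapP[j].
  by rewrite mem_enum !inE => /andP[/eqP jj0 _] /x_inj /esym.
have [->|vj] := eqVneq (v j) 0; first by rewrite mul0r.
suff /eqP -> : P.[x j] == 0 by rewrite mulr0.
by rewrite -rootE root_prod_XsubC map_f // mem_enum !inE jj0.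
Qed.

(** * The Singleton-like bound for locally recoverable codes *)

Section LinearCodes.
Variables (F : finFieldType) (n : nat) (C : {set 'rV[F]_n}) (k : nat).
Hypothesis card_C : #|C| = (#|F| ^ k)%N.

Lemma code_dim_card : submod_closed C -> code_dim C = k.
Proof.
move=> C_lin; have [C0 CZ] := C_lin.
have span_C : #|<<enum C>>%VS| = #|C|.
  apply: eq_card => v; apply/idP/idP => [/coord_span ->|vC]; last first.
    by rewrite memv_span // mem_enum.
  elim/big_ind: _ => // [x y xC yC|l _].
    by rewrite -[x]scale1r CZ.
  rewrite -[_ *: _]addr0 CZ //.
  by rewrite -mem_enum mem_nth // size_tuple.
apply/eqP; rewrite -(eqn_exp2l _ _ (finRing_gt1 F)) -card_C -span_C.
by rewrite card_vspace.
Qed.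

Hypothesis C_sub : {in C &, forall c d, c - d \in C}.

(** Pigeonhole: restriction to [U] takes at most [#|F| ^ #|U|] values, so two distinct codewords
    agree on [U], and their difference is the witness. *)
Lemma vanishing_codeword (U : {set 'I_n}) : (#|U| < k)%N ->
  exists2 c, c \in C & c != 0 /\ {in U, forall j, c ord0 j = 0}.
Proof.
move=> ltUk; pose f (c : 'rV[F]_n) := [ffun l : 'I_#|U| => c ord0 (enum_val l)].
have /dinjectivePn[c cC [d /andP[/= dc dC] fcd]] : ~~ dinjectiveb f C.
  apply/negP => /dinjectiveP /card_in_imset Ef.
  have := max_card (mem (f @: C)); rewrite Ef card_C card_ffun card_ord.
  by rewrite leq_exp2l ?finRing_gt1 // leqNgt ltUk.
exists (c - d); first exact: C_sub.
split=> [|j jU]; first by rewrite subr_eq0 eq_sym.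
have := congr1 (fun g : {ffun _} => g (enum_rank_in jU j)) fcd.
by rewrite !ffunE enum_rankK_in // => E; rewrite !mxE E subrr.
Qed.

Variables (r delta : nat).
Hypothesis C_lrc : is_LRC r delta C.

(* [T] is determined by the coordinates in [I]: a rank-free form of the
   statement that [T] has rank at most [#|I|]. *)
Lemma LRC_determined_set (j : nat) : (j * r < k + r)%N ->
  exists I T : {set 'I_n},
    [/\ (#|I| <= j * r)%N, (#|I| + j * (delta - 1) <= #|T|)%N &
      {in C, forall c : 'rV[F]_n,
        {in I, forall x, c ord0 x = 0} -> {in T, forall x, c ord0 x = 0}}].
Proof.
have [r_gt0 d_ge2 C_loc] := C_lrc.
elim: j => [|j IH] jk.
  by exists set0, set0; split; rewrite ?cards0 // => c _ _ x; rewrite inE.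
have [|I [T [leI leT IT]]] := IH; first by lia.
(* At this stage the hypothesis reads [j * r < k], whence [#|I| < k]. The word [c] vanishes on [T]
   but not at [x], so the recovery set [S] of [x] has at least [delta] points outside [T]. *)
have [|c cC [c0 cI]] := @vanishing_codeword I; first by lia.
have cT := IT c cC cI.
have [x cx] := row_neq0_coord _ _ _ c0.
have [S [xS leS S_dist]] := C_loc x.
have S_T (e : 'rV[F]_n) : {in T, forall y, e ord0 y = 0} ->
    [set y in S | e ord0 y != 0] \subset S :\: T.
  move=> eT; apply/subsetP => y; rewrite !inE => /andP[-> ey].
  by rewrite andbT; apply: contraNN ey => /eT ->.
have leST : (delta <= #|S :\: T|)%N.
  apply: leq_trans (subset_leq_card (S_T c cT)); apply: S_dist => //.
  by apply/existsP; exists x; rewrite xS.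
(* All of [S :\: T] except [delta - 1] points joins [I]. A codeword vanishing on [T] and on the new
   [I] has fewer than [delta] nonzero entries in [S], hence none, so all of [S] may join [T]. The
   set [I] grows by at most [r]. *)
have /card_geqP[D [uD sD DST]] : (delta - 1 <= #|S :\: T|)%N by lia.
pose DD := [set y in D].
have cDD : #|DD| = (delta - 1)%N by rewrite cardsE (card_uniqP uD).
have sDD : DD \subset S :\: T by apply/subsetP => y; rewrite inE => /DST.
have cSTD : #|(S :\: T) :\: DD| = (#|S :\: T| - (delta - 1))%N.
  by rewrite cardsD (setIidPr sDD) cDD.
have leSTS : (#|S :\: T| <= #|S|)%N by rewrite subset_leq_card // subsetDl.
exists (I :|: ((S :\: T) :\: DD)), (T :|: S).
have cTS : #|T :|: S| = (#|T| + #|S :\: T|)%N.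
  rewrite -cardsUI (_ : T :|: S :\: T = T :|: S); last first.
    by apply/setP => y; rewrite !inE; case: (y \in T).
  rewrite (_ : T :&: _ = set0) ?cards0 ?addn0 //.
  by apply/setP => y; rewrite !inE; case: (y \in T).
have [leIU _] := leq_card_setU I ((S :\: T) :\: DD).
split; [lia | rewrite cTS; lia | move=> e eC eI].
have eT : {in T, forall y, e ord0 y = 0}.
  by apply: IT => // y yI; apply: eI; rewrite inE yI.
move=> y; rewrite inE; have [/eT //|yT /= yS] := boolP (y \in T).
apply/eqP; apply: contraT => ey.
have : (delta <= #|[set z in S | e ord0 z != 0%R]|)%N.
  by apply: S_dist => //; apply/existsP; exists y; rewrite yS.
suff /subset_leq_card : [set z in S | e ord0 z != 0] \subset DD by lia.
apply/subsetP => z zS; have := subsetP (S_T e eT) z zS.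
move: zS; rewrite inE => /andP[_ ez] zST; apply: contraR ez => zD.
by rewrite eI // inE !in_setD zD -in_setD zST orbT.
Qed.

(** Enlarge [I] to [k - 1] points by a set [E] outside [T], as far as there is room. A nonzero
    codeword vanishing on [I] and [E] also vanishes on [T], so its support avoids both [T] and
    [E]. *)
Lemma LRC_singleton_bound (j : nat) : (j * r < k)%N ->
  exists2 c, c \in C & c != 0 /\ (wt c + k + j * (delta - 1) <= n.+1)%N.
Proof.
move=> jk; have [|I [T [leI leT IT]]] := @LRC_determined_set j; first by lia.
have [E [sET cE]] : exists E : {set 'I_n}, E \subset ~: T /\
    #|E| = minn (k.-1 - #|I|) #|~: T|.
  have /card_geqP[s [us ss sT]] := geq_minr (k.-1 - #|I|) #|~: T|.
  exists [set x in s]; split; first by apply/subsetP => y; rewrite inE => /sT.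
  by rewrite cardsE (card_uniqP us).
have [cIE _] := leq_card_setU I E.
have [|c cC [c0 cI]] := @vanishing_codeword (I :|: E).
  by lia.
exists c => //; split=> //.
have cT : {in T, forall y, c ord0 y = 0}.
  by apply: IT => // y yI; apply: cI; rewrite inE yI.
have cTE : [set y | c ord0 y != 0] \subset ~: T :\: E.
  apply/subsetP => y; rewrite !inE => cy; apply/andP; split.
    by apply: contraNN cy => yE; rewrite cI // inE yE orbT.
  by apply: contraNN cy => /cT ->.
have [y cy] := row_neq0_coord _ _ _ c0.
(* Positive weight rules out that [E] exhausts the complement of [T], so the minimum in [cE] is
   [k.-1 - #|I|]. *)
have w_gt0 : (0 < wt c)%N by apply/card_gt0P; exists y; rewrite inE.
move: (subset_leq_card cTE); rewrite cardsD (setIidPr sET) -/(wt c).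
have := cardsC T; rewrite card_ord.
move: cE leT leI jk w_gt0; move: (wt c) #|T| #|~: T| #|E| #|I|.
move: (j * (delta - 1))%N (j * r)%N => ? ? ? ? ? ? ?; lia.
Qed.

End LinearCodes.

(** * Generator polynomials and their descent to the subfield *)

Lemma horner_map_rVpoly (F K : fieldType) (iota : {rmorphism F -> K}) (n : nat)
    (v : 'rV[F]_n) (z : K) :
  (map_poly iota (rVpoly v)).[z] = \sum_(j < n) iota (v ord0 j) * z ^+ j.
Proof.
rewrite (@horner_coef_wide _ n) ?size_map_poly ?size_poly //.
by apply: eq_bigr => j _; rewrite coef_map coef_rVpoly_ord.
Qed.

Lemma gen_poly_dvdp (K : finFieldType) (Z : {set K}) (p : {poly K}) :
  (gen_poly Z %| p) = [forall z in Z, root p z].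
Proof.
rewrite /gen_poly -big_enum /=; apply/idP/forall_inP => [gp z zZ|rp].
  by apply: (root_dvdp gp); rewrite root_prod_XsubC mem_enum.
apply: uniq_roots_dvdp; last by rewrite uniq_rootsE enum_uniq.
by apply/allP => z; rewrite mem_enum => /rp.
Qed.

Lemma gen_poly_monic (K : finFieldType) (Z : {set K}) : gen_poly Z \is monic.
Proof. exact: monic_prod_XsubC. Qed.

Lemma size_gen_poly (K : finFieldType) (Z : {set K}) :
  size (gen_poly Z) = #|Z|.+1.
Proof. by rewrite /gen_poly -big_enum size_prod_XsubC -cardE. Qed.

(** Such an [x] is a root of the polynomial [X^q - X] with [q = #|F|], which splits over [F] with
    the elements of [F] as its roots. *)
Lemma fixed_power_in_image (F K : finFieldType) (iota : {rmorphism F -> K})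
    (x : K) : x ^+ #|F| = x -> exists a, x = iota a.
Proof.
move=> xq; have := congr1 (map_poly iota) (finField_genPoly F).
rewrite rmorphB /= map_polyXn map_polyX -big_enum /= map_prod_XsubC /=.
move/(congr1 (fun p : {poly K} => p.[x])); rewrite !hornerE xq subrr => /esym/eqP.
rewrite -rootE -(big_map iota predT (fun y => 'X - y%:P)) root_prod_XsubC.
by case/mapP => a _ ->; exists a.
Qed.

(** The map [z ^+ #|F|] is an automorphism of [K] that permutes [Z]; it therefore fixes every
    coefficient of [gen_poly Z]. *)
Lemma gen_poly_descent (F K : finFieldType) (iota : {rmorphism F -> K})
    (Z : {set K}) : {in Z, forall z, z ^+ #|F| \in Z} ->
  exists g : {poly F}, map_poly iota g = gen_poly Z.
Proof.
move=> Zq; pose f (x : K) := x ^+ #|F|.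
have fB : zmod_morphism f.
  (* [#|F|] is a power of the characteristic [p], which [K] shares through [iota], so additivity
     follows by iterating the Frobenius map. *)
  have [p _ pcharFp] := finPcharP F; rewrite /f (card_pprimeChar pcharFp).
  elim: (logn _ _) => // e IHe x y; rewrite expnSr !exprM {}IHe.
  by rewrite -(fmorph_pchar iota) in pcharFp; rewrite -pFrobenius_autE rmorphB.
have fM : monoid_morphism f.
  by rewrite /f; split=> [|x y]; rewrite ?exprMn ?expr1n.
pose fBM := GRing.isZmodMorphism.Build _ _ f fB.
pose fMM := GRing.isMonoidMorphism.Build _ _ f fM.
pose phi : {rmorphism K -> K} := HB.pack f fBM fMM.
have phiZ : phi @: Z = Z.
  apply/eqP; rewrite eqEcard card_imset ?leqnn ?andbT; last exact: (fmorph_inj phi).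
  by apply/subsetP => _ /imsetP[z zZ ->]; apply: Zq.
have gZ : map_poly phi (gen_poly Z) = gen_poly Z.
  rewrite -[in RHS]phiZ /gen_poly map_prod_XsubC big_imset // => x y _ _.
  exact: (fmorph_inj phi).
have coefZ j : exists a, (gen_poly Z)`_j = iota a.
  apply: fixed_power_in_image.
  by rewrite -[in RHS]gZ coef_map.
have [a aE] := fin_all_exists (fun j : 'I_#|Z|.+1 => coefZ j).
exists (\poly_(j < #|Z|.+1) a (inord j)); apply/polyP => j.
rewrite coef_map coef_poly; case: ltnP => [jZ|Zj].
  by rewrite /= -aE inordK.
by rewrite /= rmorph0 nth_default // size_gen_poly.
Qed.

Lemma size_modXn_sub1 (K : fieldType) (n : nat) (p : {poly K}) : (0 < n)%N ->
  (size (p %% ('X^n - 1))%R <= n)%N.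
Proof.
move=> n_gt0; rewrite -ltnS -[X in (_ < X)%N](size_XnsubC (1 : K) n_gt0).
by rewrite ltn_modp monic_neq0 // monicXnsubC.
Qed.

Lemma root_modXn_sub1 (K : fieldType) (n : nat) (p : {poly K}) (z : K) :
  z ^+ n = 1 -> root (p %% ('X^n - 1)) z = root p z.
Proof.
move=> zn; rewrite [in RHS](divp_eq p ('X^n - 1)) !rootE hornerD hornerM.
by rewrite !hornerE zn subrr mulr0 add0r.
Qed.

(** * Cyclic codes over the subfield *)

Section CyclicSubCode.
Variables (F K : finFieldType) (iota : {rmorphism F -> K}) (n : nat).
Variable Z : {set K}.
Hypothesis n_gt0 : (0 < n)%N.
Hypothesis Z_unity : {in Z, forall z, z ^+ n = 1}.
Hypothesis Z_closed : {in Z, forall z, z ^+ #|F| \in Z}.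
Let C := cyc_code_sub iota n Z.

Lemma gen_poly_dvd_modXn_sub1 (p : {poly K}) :
  (gen_poly Z %| p %% ('X^n - 1)) = (gen_poly Z %| p).
Proof.
rewrite !gen_poly_dvdp; apply: eq_forallb => z.
by case: (boolP (z \in Z)) => //= /Z_unity zn; rewrite root_modXn_sub1.
Qed.

(** Reduction modulo [X^n - 1] preserves divisibility because the generator divides [X^n - 1]. For
    the converse the cofactor must have coefficients in [F], which the descended generator
    provides. *)
Lemma cyc_code_sub_dvdp (c : 'rV[F]_n) :
  (c \in C) = (gen_poly Z %| map_poly iota (rVpoly c)).
Proof.
rewrite inE; apply/existsP/idP => [[f /eqP ->]|].
  by rewrite gen_poly_dvd_modXn_sub1 dvdp_mull.
have [g gE] := gen_poly_descent _ _ iota _ Z_closed.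
rewrite -gE dvdp_map => /dvdpP[h hE]; exists (poly_rV h).
have g0 : g != 0 by rewrite -(map_poly_eq0 iota) gE monic_neq0 ?gen_poly_monic.
have sc : (size (rVpoly c) <= n)%N by apply: size_poly.
rewrite poly_rV_K; last first.
  have [->|h0] := eqVneq h 0; first by rewrite size_poly0.
  apply: leq_trans sc; rewrite hE size_mul //.
  by rewrite -size_poly_gt0 in g0; rewrite -(prednK g0) addnS leq_addr.
rewrite -rmorphM -hE modp_small // size_map_poly.
by rewrite (size_XnsubC 1 n_gt0) ltnS.
Qed.

Lemma cyc_code_subP (c : 'rV[F]_n) :
  reflect {in Z, forall z, \sum_(j < n) iota (c ord0 j) * z ^+ j = 0} (c \in C).
Proof.
rewrite cyc_code_sub_dvdp gen_poly_dvdp.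
by apply: (iffP forall_inP) => Zc z zZ; move/(_ z zZ): Zc;
   rewrite rootE horner_map_rVpoly => /eqP.
Qed.

Lemma cyc_code_sub_linear : submod_closed C.
Proof.
split; first by rewrite cyc_code_sub_dvdp linear0 map_poly0 dvdp0.
move=> a c d; rewrite !cyc_code_sub_dvdp => cC dC.
by rewrite linearP /= rmorphD /= map_polyZ dvdp_addr // -mul_polyC dvdp_mull.
Qed.

Lemma cyc_code_sub_cyclic : is_cyclic C.
Proof.
move=> c; rewrite !cyc_code_sub_dvdp poly_rV_K ?size_modXn_sub1 // => cC.
rewrite map_modp rmorphB /= map_polyXn rmorph1 gen_poly_dvd_modXn_sub1.
by rewrite rmorphM /= dvdp_mull.
Qed.

(** Multiplication by the descended generator, of degree [#|Z|], is a bijection from the polynomials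
    of degree below [n - #|Z|] onto the code. *)
Lemma card_cyc_code_sub : #|C| = (#|F| ^ (n - #|Z|))%N.
Proof.
have leZn : (#|Z| <= n)%N.
  have : gen_poly Z %| 'X^n - 1.
    rewrite gen_poly_dvdp; apply/forall_inP => z /Z_unity zn.
    by rewrite rootE !hornerE zn subrr.
  move/dvdp_leq; rewrite monic_neq0 ?monicXnsubC // => /(_ isT).
  by rewrite size_gen_poly (size_XnsubC 1 n_gt0).
have [g gE] := gen_poly_descent _ _ iota _ Z_closed.
have sg : size g = #|Z|.+1 by rewrite -size_gen_poly -gE size_map_poly.
have g0 : g != 0 by rewrite -size_poly_gt0 sg.
pose f (u : 'rV[F]_(n - #|Z|)) : 'rV[F]_n := poly_rV (rVpoly u * g).
have fE u : rVpoly (f u) = rVpoly u * g.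
  rewrite poly_rV_K // (leq_trans (size_polyMleq _ _)) // sg addnS /=.
  by rewrite addnC -leq_subRL // size_poly.
have f_inj : injective f.
  move=> u v /(congr1 rVpoly); rewrite !fE => /(mulIf g0).
  exact: (can_inj (@rVpolyK _ _)).
suff -> : C = f @: setT by rewrite card_imset // cardsT card_mx mul1n.
apply/setP => c; rewrite cyc_code_sub_dvdp -gE dvdp_map.
apply/dvdpP/imsetP => [[h hE]|[u _ ->]]; last by exists (rVpoly u); rewrite fE.
have sh : (size h <= n - #|Z|)%N.
  have [->|h0] := eqVneq h 0; first by rewrite size_poly0.
  have : (size (rVpoly c) <= n)%N by apply: size_poly.
  by rewrite hE size_mul // sg addnS addnC leq_subRL.
exists (poly_rV h) => //; apply: (can_inj (@rVpolyK _ _)).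
by rewrite fE poly_rV_K.
Qed.

End CyclicSubCode.

(** * Zeros of codewords, the BCH bound and dual codes *)

(** This is the subfield case for the identity embedding, where closure under the Frobenius power is
    automatic. *)
Lemma cyc_codeP (K : finFieldType) (n : nat) (Z : {set K}) (c : 'rV[K]_n) :
  (0 < n)%N -> {in Z, forall z, z ^+ n = 1} ->
  reflect {in Z, forall z, \sum_(j < n) c ord0 j * z ^+ j = 0}
    (c \in cyc_code n Z).
Proof.
move=> n_gt0 Z1; have -> : cyc_code n Z = cyc_code_sub idfun n Z.
  apply/setP => d; rewrite !inE; apply: eq_existsb => f.
  by rewrite !map_poly_id.
have Zq : {in Z, forall z, z ^+ #|K| \in Z} by move=> z zZ; rewrite expf_card.
exact: (cyc_code_subP K K idfun n Z n_gt0 Z1 Zq c).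
Qed.

(** The factors [u ^+ j] are absorbed into [v] without changing its support; what remains are power
    sums at the distinct points [z ^+ j]. *)
Lemma bch_bound (K : fieldType) (n : nat) (z u : K) (v : 'I_n -> K) (w : nat) :
    n.-primitive_root z -> u != 0 ->
    (forall l, (l < w)%N -> \sum_j v j * (u * z ^+ l) ^+ j = 0) ->
  forall j0, v j0 != 0 -> (w < #|[set j | v j != 0%R]|)%N.
Proof.
move=> z_prim u0 v0 j0 vj0.
have -> : [set j | v j != 0] = [set j | v j * u ^+ j != 0].
  by apply/setP => j; rewrite !inE mulf_eq0 negb_or expf_neq0 // andbT.
apply: (power_sums_weight _ _ _ (fun j : 'I_n => z ^+ j) _ _ _ j0).
- move=> j l /eqP; rewrite (eq_prim_root_expr z_prim) !modn_small // => /eqP.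
  exact: val_inj.
- move=> l lw; rewrite -[RHS](v0 l lw); apply: eq_bigr => j _.
  by rewrite exprMn -mulrA -!exprM [(l * j)%N]mulnC.
- by rewrite mulf_neq0 // expf_neq0.
Qed.

Lemma sum_unity_root (K : fieldType) (n : nat) (x : K) :
  x ^+ n = 1 -> x != 1 -> \sum_(j < n) x ^+ j = 0.
Proof.
move=> xn x1; apply/eqP; have := subrX1 x n; rewrite xn subrr => /esym/eqP.
by rewrite mulf_eq0 subr_eq0 (negPf x1).
Qed.

(** The word of powers of [c^-1] evaluates at [a] in [A] to the geometric sum of [a / c], which is
    zero as [a / c] is a root of unity other than 1. So it is a codeword, and [x] is orthogonal to
    it. *)
Lemma dual_cyc_code_check (K : finFieldType) (n : nat) (A : {set K})
    (x : 'rV[K]_n) (c : K) :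
    (0 < n)%N -> {in A, forall a, a ^+ n = 1} -> x \in dual_code (cyc_code n A) ->
    c ^+ n = 1 -> c \notin A -> \sum_j x ord0 j * (c^-1) ^+ j = 0.
Proof.
move=> n_gt0 A1; rewrite inE => /forall_inP dual_x cn cA.
have c0 : c != 0.
  by apply: contra_eq_neq cn => ->; rewrite expr0n gtn_eqF // eq_sym oner_neq0.
have /dual_x/eqP : (\row_j (c^-1) ^+ j) \in cyc_code n A.
  apply/cyc_codeP => // a aA; under eq_bigr do rewrite mxE -exprMn.
  apply: sum_unity_root; first by rewrite exprMn exprVn cn A1 // invr1 mulr1.
  by apply: contraNneq cA => /(congr1 ( *%R c)); rewrite mulVKf // mulr1 => <-.
by under eq_bigr do rewrite mxE.
Qed.

(** * Locality of the product code *)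

Section ProductCode.
Variables (F K : finFieldType) (iota : {rmorphism F -> K}) (n : nat).
Variables A B : {set K}.
Let AB := [set x * y | x in A, y in B].
Hypothesis A_unity : {in A, forall z, z ^+ n.+1 = 1}.
Hypothesis B_unity : {in B, forall z, z ^+ n.+1 = 1}.
Hypothesis AB_closed : {in AB, forall z, z ^+ #|F| \in AB}.
Let C := cyc_code_sub iota n.+1 AB.

Lemma product_unity : {in AB, forall z, z ^+ n.+1 = 1}.
Proof.
by move=> _ /imset2P[x y xA yB ->]; rewrite exprMn A_unity ?B_unity ?mulr1.
Qed.

Lemma dual_product_check (x : 'rV[K]_n.+1) (c : 'rV[F]_n.+1) (y : K) :
    x \in dual_code (cyc_code n.+1 A) -> c \in C -> y \in B ->
  \sum_j x ord0 j * (iota (c ord0 j) * y ^+ j) = 0.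
Proof.
rewrite inE => /forall_inP dual_x.
move=> /(cyc_code_subP _ _ _ _ _ (ltn0Sn n) product_unity AB_closed) cC yB.
have /dual_x/eqP : (\row_j (iota (c ord0 j) * y ^+ j)) \in cyc_code n.+1 A.
  apply/cyc_codeP => // a aA; rewrite -[RHS](cC (a * y)) ?imset2_f //.
  by apply: eq_bigr => j _; rewrite mxE exprMn -mulrA [_ * a ^+ j]mulrC.
by under eq_bigr do rewrite mxE.
Qed.

(** Subtraction in ['I_n.+1] is cyclic, so shifting by [a] multiplies the evaluation at an [n.+1]-th
    root of unity [z] by [z ^+ a]. *)
Lemma product_code_shift (c : 'rV[F]_n.+1) (a : 'I_n.+1) :
  c \in C -> (\row_j c ord0 (j - a)) \in C.
Proof.
move=> /(cyc_code_subP _ _ _ _ _ (ltn0Sn n) product_unity AB_closed) cC.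
apply/(cyc_code_subP _ _ _ _ _ (ltn0Sn n) product_unity AB_closed) => z zAB.
rewrite (reindex_inj (addIr a)) /=.
transitivity (z ^+ a * \sum_j iota (c ord0 j) * z ^+ j); last first.
  by rewrite cC ?mulr0.
rewrite mulr_sumr.
apply: eq_bigr => j _; rewrite mxE addrK mulrCA -exprD addnC.
by rewrite (expr_mod _ (product_unity _ zAB)).
Qed.

Lemma product_code_locality (delta : nat) (z u : K) (x : 'rV[K]_n.+1) :
    (0 < delta)%N -> n.+1.-primitive_root z -> u != 0 ->
    (forall l, (l < delta - 1)%N -> u * z ^+ l \in B) ->
    x \in dual_code (cyc_code n.+1 A) -> x != 0 -> (delta <= wt x)%N ->
  forall k, has_locality (wt x + 1 - delta) delta C k.
Proof.
move=> d_gt0 z_prim u0 zB dual_x x0 le_wt k.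
have [j1 xj1] := row_neq0_coord _ _ _ x0.
(* The shift is chosen to carry the support point [j1] of [x] to [k]. *)
pose a := j1 - k; pose sh (j : 'I_n.+1) := j - a.
have sh_inj : injective sh by apply: addIr.
exists (sh @: [set j | x ord0 j != 0]); split.
- by apply/imsetP; exists j1; rewrite ?inE // /sh /a opprB addrC subrK.
- by rewrite card_imset // -/(wt x); lia.
move=> c cC /existsP[_ /andP[/imsetP[j xj ->] cj]].
rewrite inE in xj.
(* [v] is the coordinatewise product of [x] with a shift of [c]; [sh] maps its support injectively
   into the nonzero positions of [c] in the recovery set. *)
pose v j := x ord0 j * iota (c ord0 (sh j)).
have le_v : (delta - 1 < #|[set j | v j != 0%R]|)%N.
  apply: (bch_bound _ _ _ _ _ _ z_prim u0 _ j) => [l ld|]; last first.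
    by rewrite mulf_neq0 // fmorph_eq0.
  rewrite -[RHS](dual_product_check _ _ _ dual_x (product_code_shift c a cC)
                   (zB l ld)).
  by apply: eq_bigr => y _; rewrite mxE mulrA.
have : (delta <= #|sh @: [set j | v j != 0%R]|)%N by rewrite card_imset //; lia.
move/leq_trans; apply; apply/subset_leq_card/subsetP => _ /imsetP[y vy ->].
move: vy; rewrite !inE mulf_eq0 negb_or fmorph_eq0 => /andP[xy cy].
by rewrite cy andbT; apply: imset_f; rewrite inE.
Qed.

End ProductCode.

(** * Exponents of the product set *)

Section Exponents.
Variables (m delta : nat) (i : nat -> nat).
Hypothesis m_gt0 : (0 < m)%N.
Hypothesis delta_ge3 : (3 <= delta)%N.

(* The exponents of [AB], shifted so that they start at [0] and the consecutive
   runs do not wrap around [n]. *)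
Fixpoint product_exponents (s : nat) : seq nat :=
  if s is s'.+1 then product_exponents s' ++ iota (i s') (delta - 1)
  else iota 0 (m + delta - 2).

Lemma size_product_exponents (s : nat) :
  size (product_exponents s) = (m + delta - 2 + s * (delta - 1))%N.
Proof.
by elim: s => [|s IH] /=; rewrite ?size_cat ?IH !size_iota ?mulSn; lia.
Qed.

Lemma mem_product_exponents (s e : nat) :
  reflect (exists a l, [/\ (a < m)%N \/ exists2 p, (p < s)%N & a = i p,
                           (l < delta - 1)%N & e = (a + l)%N])
    (e \in product_exponents s).
Proof.
elim: s => [|s IH] /=.
  rewrite mem_iota add0n; apply: (iffP idP) => [e_lt|[a [l [[am|[//]] ld ->]]]].
    (* The first summand is taken as large as [a < m] permits; the remainder is then below
       [delta - 1]. *)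
    by exists (minn e m.-1), (e - minn e m.-1)%N; split; [left|..]; lia.
  by lia.
rewrite mem_cat mem_iota; apply: (iffP orP).
  case=> [/IH[a [l [am ld ->]]]|/andP[ie ei]].
    exists a, l; split=> //; case: am => [|[p ps ->]]; [by left | right].
    by exists p => //; lia.
  by exists (i s), (e - i s)%N; split; [right; exists s| |]; lia.
case=> a [l [am ld eE]]; case: am => [am|[p]].
  by left; apply/IH; exists a, l; split=> //; left.
rewrite ltnS leq_eqVlt => /predU1P[-> aE|ps aE]; first by right; lia.
by left; apply/IH; exists a, l; split=> //; right; exists p.
Qed.

Hypothesis i0_ge : (m - 1 + delta <= i 0)%N.

(** The runs have length [delta - 1] after the first, and consecutive starting points differ by at
    least [delta]. The upper bound carries the induction and later keeps the exponents below the
    code length. *)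
Lemma product_exponents_uniq (s : nat) :
    (forall l, (l.+1 < s)%N -> (i l + delta <= i l.+1)%N) ->
  uniq (product_exponents s) /\
  (forall e, e \in product_exponents s ->
     e < if s is s'.+1 then i s' + delta - 1 else m + delta - 2)%N.
Proof.
elim: s => [|s IH] gaps /=.
  by split=> [|e]; rewrite ?iota_uniq // mem_iota.
have [|u_s lt_s] := IH; first by move=> l ls; apply: gaps; lia.
have lt_is e : e \in product_exponents s -> (e < i s)%N.
  move/lt_s; case: s gaps {IH u_s lt_s} => [|s] gaps; first by lia.
  by have := gaps s (leqnn _); lia.
split=> [|e]; last first.
  by rewrite mem_cat mem_iota => /orP[/lt_is|]; lia.
rewrite cat_uniq u_s iota_uniq andbT /=; apply/hasPn => e.
by rewrite mem_iota => /andP[ie _]; apply/negP => /lt_is; lia.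
Qed.

End Exponents.

(** * Parameters and optimality of the code *)

Theorem theorem5p4 (q : nat) (F K : finFieldType) (iota : {rmorphism F -> K})
  (n : nat) (alpha : K) (delta b s m t : nat) (i : nat -> nat) :
  #|F| = q -> #|K| = (q ^ 2)%N ->
  (n %| q.+1)%N -> n.-primitive_root alpha ->
  odd delta -> (3 <= delta)%N ->
  (0 < b)%N -> (0 < s)%N -> (0 < m)%N -> coprime b n ->
  (t < n)%N ->
  (m - 1 + delta <= i 0%N)%N -> (i s.-1 + delta <= n)%N ->
  (forall l : nat, (l.+1 < s)%N -> (i l + delta <= i l.+1)%N) ->
  let A : {set K} :=
    [set alpha ^+ (t + j * b) | j : 'I_m] :|:
    [set alpha ^+ (t + i l * b) | l : 'I_s] in
  let B : {set K} :=
    [set alpha ^ (((j : nat)%:Z - ((delta - 3)./2)%:Z) * b%:Z) | j : 'I_(delta - 1)] in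
  let AB : {set K} := [set x * y | x in A, y in B] in
  (forall j : 'I_n, alpha ^+ j \in AB -> alpha ^+ (j * q) \in AB) ->
  forall dAperp : nat, is_min_dist (dual_code (cyc_code n A)) dAperp ->
  let C := cyc_code_sub iota n AB in
  let r := (dAperp + 1 - delta)%N in
  [/\ is_cyclic C, is_LRC r delta C,
      (code_dim C)%:Z = n%:Z - m%:Z + 1 - (s%:Z + 1) * (delta%:Z - 1)
    & ceil_div (code_dim C) r = s.+1 ->
      is_optimal_LRC r delta C /\ is_min_dist C (m + delta - 1)].
Proof.
move=> cardF _ _ alpha_prim _ d_ge3 _ s_gt0 m_gt0 co_bn t_lt i0_ge is_le gaps.
move=> A B AB AB_q dA [[x dual_x [x0 wt_x]] _] C r.
have i_ge p : (p < s)%N -> (i 0 <= i p)%N.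
  elim: p => // p IH ps; apply: leq_trans (IH (ltnW ps)) _.
  exact: leq_trans (leq_addr _ _) (gaps p ps).
case: n => [//|n] in alpha_prim co_bn t_lt is_le A B AB AB_q x dual_x x0 wt_x C *.
(* As [b] is coprime to the length, [zeta] is again primitive. The factor [u] absorbs [alpha ^+ t]
   and the lowest exponent [-h] of [B], so [AB] consists of the [u * zeta ^+ e] with [e] in
   [product_exponents]. *)
pose zeta := alpha ^+ b; pose h := (delta - 3)./2.
pose u := alpha ^+ t / zeta ^+ h.
have zeta_prim : n.+1.-primitive_root zeta.
  by rewrite prim_root_exp_coprime.
have alpha1 : alpha ^+ n.+1 = 1 := prim_expr_order alpha_prim.
have alpha_neq0 : alpha != 0.
  by apply: contra_eq_neq alpha1 => ->; rewrite expr0n eq_sym oner_neq0.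
have zeta_neq0 : zeta != 0 by rewrite expf_neq0.
have u_neq0 : u != 0 by rewrite mulf_neq0 ?invr_eq0 ?expf_neq0.
have zeta1 : zeta ^+ n.+1 = 1 := prim_expr_order zeta_prim.
have pow1 (y : K) e : y ^+ n.+1 = 1 -> (y ^+ e) ^+ n.+1 = 1.
  by move=> y1; rewrite -exprM mulnC exprM y1 expr1n.
pose inA a := (a < m)%N \/ exists2 p, (p < s)%N & a = i p.
have AP y : reflect (exists2 a, inA a & y = alpha ^+ t * zeta ^+ a) (y \in A).
  rewrite inE; apply: (iffP orP) => [[]/imsetP[j _ ->]|[a [am|[p ps ->]] ->]].
  - by exists (j : nat); [left | rewrite exprD mulnC exprM].
  - by exists (i j); [right; exists (j : nat) | rewrite exprD mulnC exprM].
  - by left; apply/imsetP; exists (Ordinal am); rewrite // exprD mulnC exprM.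
  - by right; apply/imsetP; exists (Ordinal ps); rewrite // exprD mulnC exprM.
have BP y : reflect (exists2 l, (l < delta - 1)%N & y = (zeta ^+ h)^-1 * zeta ^+ l)
                    (y \in B).
  have BE (l : nat) : alpha ^ ((l%:Z - h%:Z) * b%:Z) = (zeta ^+ h)^-1 * zeta ^+ l.
    by rewrite mulrC -exprz_exp expfzDr // mulrC -invr_expz.
  apply: (iffP imsetP) => [[l _ ->]|[l ld ->]]; first by exists (l : nat).
  by exists (Ordinal ld); rewrite // -BE.
have ABP y : reflect (exists2 e, e \in product_exponents m delta i s &
                                 y = u * zeta ^+ e) (y \in AB).
  apply: (iffP imset2P) => [[_ _ /AP[a aA ->] /BP[l ld ->] ->]|[e]].
    exists (a + l)%N; first by apply/mem_product_exponents => //; exists a, l.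
    by rewrite exprD mulrACA.
  case/mem_product_exponents => // a [l [aA ld ->]] ->.
  exists (alpha ^+ t * zeta ^+ a) ((zeta ^+ h)^-1 * zeta ^+ l).
  - by apply/AP; exists a.
  - by apply/BP; exists l.
  - by rewrite exprD mulrACA.
have [E_uniq E_lt] := product_exponents_uniq _ _ _ m_gt0 d_ge3 i0_ge s gaps.
have E_ltn e : e \in product_exponents m delta i s -> (e < n.+1)%N.
  by move/E_lt; case: (s) s_gt0 is_le => //= s' _; clear -d_ge3; lia.
have A_unity : {in A, forall y, y ^+ n.+1 = 1}.
  by move=> _ /AP[a _ ->]; rewrite exprMn !pow1 ?mulr1.
have B_unity : {in B, forall y, y ^+ n.+1 = 1}.
  by move=> _ /BP[l _ ->]; rewrite exprMn exprVn !pow1 ?invr1 ?mulr1.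
have AB_unity := product_unity _ _ _ _ A_unity B_unity; rewrite -/AB in AB_unity.
have AB_closed : {in AB, forall y, y ^+ #|F| \in AB}.
  move=> y yAB; have [j yE] := prim_rootP alpha_prim (AB_unity y yAB).
  by rewrite cardF yE -exprM AB_q // -yE.
have cardAB : #|AB| = (m + delta - 2 + s * (delta - 1))%N.
  rewrite -(size_product_exponents _ _ i m_gt0 d_ge3 s).
  rewrite -(size_map (fun e => u * zeta ^+ e)).
  have /card_uniqP <- : uniq [seq u * zeta ^+ e | e <- product_exponents m delta i s].
    rewrite map_inj_in_uniq // => e f /E_ltn e_lt /E_ltn f_lt /(mulfI u_neq0)/eqP.
    by rewrite (eq_prim_root_expr zeta_prim) !modn_small // => /eqP.
  apply: eq_card => y; apply/ABP/mapP => [] [e eE ->]; by exists e.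
have E_le : (m + delta - 2 + s * (delta - 1) <= n.+1)%N.
  rewrite -(size_product_exponents _ _ i m_gt0 d_ge3 s) -[leqRHS](size_iota 0 n.+1).
  apply: uniq_leq_size => // e /E_ltn e_lt; rewrite mem_iota; exact: e_lt.
have le_dA : (delta <= dA)%N.
  have [j1 xj1] := row_neq0_coord _ _ _ x0.
  suff : (delta - 1 < wt x)%N by rewrite wt_x; clear -d_ge3; lia.
  (* The exponents [m] to [m + delta - 2] lie strictly between [m - 1] and [i 0], so they are
     missing from [A]. Their inverses give [delta - 1] consecutive zeros of [x]; inversion reverses
     the order, so the run starts at the top exponent. *)
  pose w := alpha ^+ t * zeta ^+ (m + delta - 2).
  have w0 : w != 0 by rewrite mulf_neq0 ?expf_neq0.
  apply: (bch_bound _ _ zeta w^-1 _ _ zeta_prim _ _ j1) => // [|l ld].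
    by rewrite invr_eq0.
  pose e := (m + delta - 2 - l)%N.
  have wE : w^-1 * zeta ^+ l = (alpha ^+ t * zeta ^+ e)^-1.
    have -> : w = alpha ^+ t * zeta ^+ e * zeta ^+ l.
      by rewrite -mulrA -exprD subnK //; clear -ld m_gt0 d_ge3; lia.
    by rewrite [in LHS](invfM (_ * _)) divfK ?expf_neq0.
  rewrite wE; apply: (dual_cyc_code_check _ _ A) => //.
    by rewrite exprMn !pow1 ?mulr1.
  apply/AP => -[a aA /(mulfI (expf_neq0 t alpha_neq0))/eqP].
  rewrite (eq_prim_root_expr zeta_prim) !modn_small => [/eqP ea||].
  - move: ea; rewrite /e; case: aA => [|[p /i_ge]];
      clear -ld m_gt0 i0_ge d_ge3; lia.
  (* With second summand 0, an exponent of [A] is itself in [product_exponents], hence below the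
     length. *)
  - apply: E_ltn; apply/mem_product_exponents => //; exists a, 0%N.
    by split; [|clear -d_ge3; lia | rewrite addn0].
  - rewrite /e; have := i_ge s.-1.
    by clear -ld m_gt0 i0_ge d_ge3 is_le s_gt0; lia.
have LRC_C : is_LRC r delta C.
  split; rewrite /r; [by clear -le_dA; lia | exact: ltnW |].
  rewrite -wt_x; apply: (product_code_locality _ _ _ _ A B A_unity B_unity
     AB_closed delta zeta (zeta ^+ h)^-1) => //; rewrite ?wt_x //.
  - exact: leq_trans d_ge3.
  - by rewrite invr_eq0 expf_neq0.
  - by move=> l ld; apply/BP; exists l.
have le_wt c : c \in C -> c != 0 -> (m + delta - 1 <= wt c)%N.
  move=> /(cyc_code_subP _ _ _ _ _ (ltn0Sn n) AB_unity AB_closed) cC c0.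
  have [j1 cj1] := row_neq0_coord _ _ _ c0.
  suff : (m + delta - 2 < wt c)%N by clear -m_gt0 d_ge3; lia.
  have -> : wt c = #|[set j | iota (c ord0 j) != 0]|.
    by apply: eq_card => j; rewrite !inE fmorph_eq0.
  apply: (bch_bound _ _ _ _ _ _ zeta_prim u_neq0 _ j1).
    move=> l ld; apply: cC; apply/ABP; exists l => //.
    apply/mem_product_exponents => //.
    exists (minn l m.-1), (l - minn l m.-1)%N; 
    by split; [left|..]; clear -ld m_gt0 d_ge3; lia.
  by rewrite fmorph_eq0.
have cardC := card_cyc_code_sub _ _ iota _ _ (ltn0Sn n) AB_unity AB_closed.
have C_lin := cyc_code_sub_linear _ _ iota _ _ (ltn0Sn n) AB_unity AB_closed.
rewrite -/C in cardC C_lin.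
have dimC := code_dim_card _ _ _ _ cardC C_lin.
have dimZ : (code_dim C)%:Z = n.+1%:Z - m%:Z + 1 - (s%:Z + 1) * (delta%:Z - 1).
  by rewrite dimC cardAB; clear -E_le m_gt0 d_ge3; lia.
split=> //; first exact: cyc_code_sub_cyclic.
move=> ceil_s.
have min_C : is_min_dist C (m + delta - 1).
  have C_sub : {in C &, forall c d, c - d \in C}.
    by move=> c d cC dC; rewrite addrC -scaleN1r C_lin.2.
  have [|c cC [c0 wt_c]] := LRC_singleton_bound _ _ _ _ cardC C_sub _ _ LRC_C s.
    (* The ceiling being [s.+1] gives [s.+1 * r <= k + r - 1] for the dimension [k], that is
       [s * r < k], so the bound applies with [j = s]. *)
    have := leq_trunc_div (code_dim C + r - 1) r.
    move: ceil_s; rewrite /ceil_div => ->; rewrite -dimC.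
    by have [r_gt0 _ _] := LRC_C; rewrite mulSn; clear -r_gt0; lia.
  (* As the codimension is [m + delta - 2 + s * (delta - 1)], the bound reads
     [wt c <= m + delta - 1]. *)
  split=> //; exists c => //; split=> //; have := le_wt c cC c0.
  by move: wt_c; rewrite cardAB; clear -E_le m_gt0 d_ge3; lia.
split=> //; split=> //; exists (m + delta - 1)%N; split=> //.
by rewrite ceil_s dimZ; clear -m_gt0 d_ge3; lia.
Qed.
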